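(* Let $X$ be a Euclidean space. For blades $A,B\in\bigwedge^pX$ ($p\ge1$) we have $$\tilde A\boxtimes B=\|A\|\|B\|\cosh\Phi_{A,B}\qquad\text{and}\qquad \tilde A\times B=\|A\|\|B\|\sinh\Phi_{A,B},$$ where $\Phi_{A,B}$ is the oriented angle bivector from $[A]$ to $[B]$ (formed with given associated principal bases).
   Context: $X$ is an $n$-dimensional Euclidean space. $\bigwedge X$ is its exterior algebra, equipped with the Clifford geometric product (written by juxtaposition), for which $vw=v\cdot w+v\wedge w$ for $v,w\in X$. $\bigwedge X$ carries the usual inner product and norm $\|\cdot\|$. A $p$-blade ($p\ge1$) is $A=v_1\wedge\cdots\wedge v_p$ with $v_i\in X$ (possibly $0$); its reversion is $\tilde A=v_p\wedge\cdots\wedge v_1=(-1)^{p(p-1)/2}A$; if $A\ne0$, $[A]=\mathrm{span}(v_1,\ldots,v_p)$. For $M,N\in\bigwedge X$: the commutator is $M\times N=(MN-NM)/2$, the anticommutator is $M\boxtimes N=(MN+NM)/2$, $e^M=\sum_{k\ge0}M^k/k!$, $\cosh M=\frac{e^M+e^{-M}}2$ and $\sinh M=\frac{e^M-e^{-M}}2$. For $A,B\neq0$ let $V=[A]$, $W=[B]$. Their principal angles $0\le\theta_1\le\cdots\le\theta_p\le\frac\pi2$ and associated principal bases (orthonormal bases) $(e_1,\ldots,e_p)$ of $V$ and $(f_1,\ldots,f_p)$ of $W$ are characterized by $e_i\cdot f_j=\delta_{ij}\cos\theta_i$ for all $i,j$. Let $d=\dim(V\cap W)$. The principal bivectors are $I_i=0$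 for $i\le d$ and $I_i=\frac{e_i\wedge f_i}{\|e_i\wedge f_i\|}$ for $i>d$. The angle bivector is $\Phi_{V,W}=\sum_{i=1}^p\theta_iI_i$. Write $A=\epsilon_A\|A\|e_1\cdots e_p$ and $B=\epsilon_B\|B\|f_1\cdots f_p$ with $\epsilon_A,\epsilon_B\in\{1,-1\}$, and $\epsilon_{A,B}=\epsilon_A\epsilon_B$. The oriented angle bivector is $\Phi_{A,B}=\Phi_{V,W}$ if $\epsilon_{A,B}=1$, and $\Phi_{A,B}=\Phi_{V,W}-\pi I_p$ if $\epsilon_{A,B}=-1$. If $A=0$ or $B=0$, $\Phi_{A,B}=0$.
   Formalization: X is R^n with its standard inner product; the cosh identity is stated except when A≠0 and B=-cA with c>0, where it fails as written (all I_i=0, so Φ_{A,B}=0, yet Ã⊠B=-‖A‖‖B‖); the sinh identity is unrestricted. *)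

(* Defs.v *)
From HB Require Import structures.
From mathcomp Require Import all_boot all_order all_algebra ring.
From mathcomp Require Import all_classical all_reals all_analysis.
Import Order.TTheory GRing.Theory Num.Theory.
Import numFieldNormedType.Exports.

Set Implicit Arguments.
Unset Strict Implicit.
Unset Printing Implicit Defensive.

Local Open Scope ring_scope.

(* The Euclidean space X is 'rV[R]_n with its standard inner product, and a
   multivector M = \sum_S M_S e_S is given by its coordinates M_S in the basis
   e_S = e_(i_1) /\ ... /\ e_(i_k) of the exterior algebra, where
   S = {i_1 < ... < i_k} and (e_i) is the canonical basis of R^n. *)

Definition dotv (R : realType) (n : nat) (u v : 'rV[R]_n) : R :=
  \sum_i u 0 i * v 0 i.

Definition multivector (R : realType) (n : nat) := {ffun {set 'I_n} -> R}.

Section Algebra.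
Context {R : realType} {n : nat}.
Implicit Types (S T U : {set 'I_n}) (M N P : multivector R n) (u v : 'rV[R]_n).

HB.instance Definition _ :=
  GRing.Lmodule.copy (multivector R n) {ffun {set 'I_n} -> R^o}.

Definition symdiff S T : {set 'I_n} := [set i | (i \in S) (+) (i \in T)].

(* The sign of the permutation that sorts the concatenation of the increasing
   enumerations of S and T, so that e_S e_T = reorder_sign S T *: e_(symdiff S T)
   for the geometric product. *)
Definition reorder_sign S T : R := \prod_(i in S) \prod_(j in T | (j < i)%N) -1.

Definition geom M N : multivector R n :=
  [ffun U => \sum_(S : {set 'I_n}) \sum_(T : {set 'I_n} | symdiff S T == U) reorder_sign S T * M S * N T].

Definition wedge M N : multivector R n :=
  [ffun U => \sum_(S : {set 'I_n}) \sum_(T : {set 'I_n} | [disjoint S & T] && (S :|: T == U))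
     reorder_sign S T * M S * N T].

Definition scalar_mv (a : R) : multivector R n := [ffun S => a *+ (S == finset.set0)].

Definition vector_mv v : multivector R n :=
  [ffun S => \sum_i v 0 i *+ (S == finset.set1 i)].

Definition dot_mv M N : R := \sum_(S : {set 'I_n}) M S * N S.

Definition norm_mv M : R := Num.sqrt (dot_mv M M).

Lemma symdiffA : associative symdiff.
Proof. by move=> S T U; apply/setP=> i; rewrite !inE addbA. Qed.

Lemma symdiffC : commutative symdiff.
Proof. by move=> S T; apply/setP=> i; rewrite !inE addbC. Qed.

Lemma symdiffK S : involutive (symdiff S).
Proof. by move=> T; apply/setP=> i; rewrite !inE addbA addbb. Qed.

Lemma symdiff0 S : symdiff S finset.set0 = S.
Proof. by apply/setP=> i; rewrite !inE addbF. Qed.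

Lemma symdiff_eq S T U : (symdiff S T == U) = (T == symdiff S U).
Proof. by apply/eqP/eqP => [<-|->]; rewrite symdiffK. Qed.

Lemma prod_symdiff (F : 'I_n -> R) S T : (forall i, F i * F i = 1) ->
  \prod_(i in symdiff S T) F i = \prod_(i in S) F i * \prod_(i in T) F i.
Proof.
move=> F2; rewrite [LHS]big_mkcond [X in X * _]big_mkcond [X in _ * X]big_mkcond.
rewrite -big_split; apply: eq_bigr => i _; rewrite inE /=.
by case: (i \in S); case: (i \in T); rewrite /= ?F2 ?mulr1 ?mul1r.
Qed.

Lemma reorder_signDl S T U :
  reorder_sign (symdiff S T) U = reorder_sign S U * reorder_sign T U.
Proof.
apply: prod_symdiff => i; rewrite -big_split big1 // => j _ /=.
by rewrite mulrNN mulr1.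
Qed.

Lemma reorder_signDr S T U :
  reorder_sign S (symdiff T U) = reorder_sign S T * reorder_sign S U.
Proof.
rewrite /reorder_sign -big_split; apply: eq_bigr => i _ /=.
rewrite !big_mkcondr; apply: prod_symdiff => j.
by case: ifP; rewrite ?mulrNN mulr1.
Qed.

Lemma reorder_sign0l S : reorder_sign finset.set0 S = 1.
Proof. by rewrite /reorder_sign big_set0. Qed.

Lemma reorder_sign0r S : reorder_sign S finset.set0 = 1.
Proof.
by rewrite /reorder_sign big1 // => i _; rewrite big1 // => j; rewrite inE.
Qed.

Lemma geomE M N U : geom M N U =
  \sum_S reorder_sign S (symdiff S U) * M S * N (symdiff S U).
Proof.
rewrite ffunE; apply: eq_bigr => S _.
by under eq_bigl do rewrite symdiff_eq; rewrite big_pred1_eq.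
Qed.

Lemma geomA : associative geom.
Proof.
move=> M N P; apply/ffunP=> U; rewrite !geomE.
under [RHS]eq_bigr do rewrite geomE mulr_sumr mulr_suml.
rewrite [RHS]exchange_big; apply: eq_bigr => S _ /=.
rewrite geomE mulr_sumr [RHS](reindex_inj (inv_inj (symdiffK S))).
apply: eq_bigr => T _; rewrite symdiffK.
set V := symdiff T (symdiff S U).
have -> : symdiff (symdiff S T) U = V by rewrite /V symdiffA (symdiffC T).
have -> : symdiff S U = symdiff T V by rewrite symdiffK.
rewrite reorder_signDl reorder_signDr.
by ring.
Qed.

Lemma geom_scalarl a M : geom (scalar_mv a) M = a *: M.
Proof.
apply/ffunP=> U; rewrite geomE (bigD1 finset.set0) //= big1 ?addr0 => [|S S0].
  rewrite !ffunE eqxx reorder_sign0l mul1r (symdiffC finset.set0) symdiff0.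
  by rewrite mulr1n.
by rewrite ffunE (negPf S0) mulr0 mul0r.
Qed.

Lemma geom_scalarr a M : geom M (scalar_mv a) = a *: M.
Proof.
apply/ffunP=> U; rewrite geomE (bigD1 U) //= big1 ?addr0 => [|S SU].
  have -> : symdiff U U = finset.set0 by apply/setP => i; rewrite !inE addbb.
  by rewrite !ffunE eqxx reorder_sign0r mul1r mulrC.
by rewrite ffunE symdiff_eq symdiff0 eq_sym (negPf SU) mulr0.
Qed.

Lemma geomDl : left_distributive geom +%R.
Proof.
move=> M N P; apply/ffunP=> U; rewrite [RHS]ffunE !geomE -big_split.
by apply: eq_bigr => S _; rewrite ffunE mulrDr mulrDl.
Qed.

Lemma geomDr : right_distributive geom +%R.
Proof.
move=> M N P; apply/ffunP=> U; rewrite [RHS]ffunE !geomE -big_split.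
by apply: eq_bigr => S _; rewrite ffunE mulrDr.
Qed.

Lemma geom1l : left_id (scalar_mv 1) geom.
Proof. by move=> M; rewrite geom_scalarl scale1r. Qed.

Lemma geom1r : right_id (scalar_mv 1) geom.
Proof. by move=> M; rewrite geom_scalarr scale1r. Qed.

Lemma scalar_mv1_neq0 : scalar_mv 1 != 0.
Proof.
apply/eqP => /ffunP/(_ finset.set0)/eqP.
by rewrite !ffunE eqxx mulr1n oner_eq0.
Qed.

HB.instance Definition _ := GRing.Zmodule_isNzRing.Build (multivector R n)
  geomA geom1l geom1r geomDl geomDr scalar_mv1_neq0.

Lemma geomZl a M N : a *: (M * N) = a *: M * N.
Proof. by rewrite -!geom_scalarl [LHS]geomA. Qed.

Lemma geomZr a M N : a *: (M * N) = M * (a *: N).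
Proof.
by rewrite -[LHS]geom_scalarr -[LHS]geomA; congr geom; rewrite geom_scalarr.
Qed.

HB.instance Definition _ :=
  GRing.Lmodule_isLalgebra.Build R (multivector R n) geomZl.
HB.instance Definition _ :=
  GRing.Lalgebra_isAlgebra.Build R (multivector R n) geomZr.

Lemma scale_scalar_mv a : a%:A = scalar_mv a :> multivector R n.
Proof. by rewrite -geom_scalarl; exact: geom1r. Qed.

Lemma sum_vector_mv (F : {set 'I_n} -> R) u :
  \sum_S F S * vector_mv u S = \sum_i F (finset.set1 i) * u 0 i.
Proof.
under eq_bigr do rewrite ffunE mulr_sumr.
rewrite exchange_big; apply: eq_bigr => i _ /=.
rewrite (bigD1 (finset.set1 i)) //= eqxx big1 ?addr0 // => S /negPf ->.
by rewrite mulr0.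
Qed.

Lemma vector_mvM u v :
  vector_mv u * vector_mv v =
  (dotv u v)%:A + wedge (vector_mv u) (vector_mv v).
Proof.
have sumE (p : {set 'I_n} -> {set 'I_n} -> bool) :
    \sum_S \sum_(T | p S T) reorder_sign S T * vector_mv u S * vector_mv v T =
    \sum_i \sum_j u 0 i * (reorder_sign (finset.set1 i) (finset.set1 j) * v 0 j)
                  *+ p (finset.set1 i) (finset.set1 j).
  pose G S := \sum_T (reorder_sign S T *+ p S T) * vector_mv v T.
  rewrite (eq_bigr (fun S => G S * vector_mv u S)) => [|S _]; last first.
    rewrite /G mulr_suml big_mkcond; apply: eq_bigr => T _.
    by case: (p S T); rewrite ?mulr0n ?mul0r // mulr1n mulrAC.
  rewrite sum_vector_mv; apply: eq_bigr => i _; rewrite /G sum_vector_mv mulr_suml.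
  apply: eq_bigr => j _.
  by case: (p _ _); rewrite ?mulr0n ?mul0r // !mulr1n mulrC.
apply/ffunP => U; rewrite [LHS]ffunE [RHS]ffunE [in X in _ + X]ffunE.
rewrite !sumE.
have -> : ((dotv u v)%:A : multivector R n) U =
    \sum_i \sum_j u 0 i * v 0 j *+ ((i == j) && (U == finset.set0)).
  rewrite scale_scalar_mv ffunE -sumrMnl.
  apply: eq_bigr => i _; rewrite (bigD1 i) //= eqxx big1 ?addr0 // => j /negPf.
  by rewrite eq_sym => ->.
rewrite -big_split; apply: eq_bigr => i _; rewrite -big_split.
apply: eq_bigr => j _ /=; rewrite disjoints1 inE.
have [<-|ij] := eqVneq i j; rewrite /= ?add0r ?addr0.
  have -> : symdiff (finset.set1 i) (finset.set1 i) = finset.set0.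
    by apply/setP => k; rewrite !inE addbb.
  rewrite eq_sym /reorder_sign big_set1 big1 ?mul1r // => k.
  by rewrite inE => /andP[/eqP ->]; rewrite ltnn.
congr (_ *+ (_ == _)); apply/setP => k; rewrite !inE.
by have [->|//] := eqVneq k i; rewrite (negPf ij).
Qed.

(* The norms being equivalent, the convergence of the exponential series is that
   of its coordinates; see is_cvg_exp_mv. *)
Definition exp_mv M : multivector R n :=
  [ffun S => limn (series (fun k => ((k`!%:R)^-1 *: M ^+ k : multivector R n) S))].

Lemma is_cvg_exp_mv M S :
  cvgn (series (fun k => ((k`!%:R)^-1 *: M ^+ k : multivector R n) S)).
Proof.
pose l1 N := \sum_T `|N T|.
have sign1 T U : `|reorder_sign T U| = 1.
  rewrite /reorder_sign normr_prod big1 // => i _.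
  by rewrite normr_prod big1 // => j _; rewrite normrN1.
have l1M N P : l1 (N * P) <= l1 N * l1 P.
  have l1E T : l1 P = \sum_U `|P (symdiff T U)|.
    by rewrite [LHS](reindex_inj (inv_inj (symdiffK T))).
  rewrite {2}/l1 mulr_suml; under [leRHS]eq_bigr => T _ do rewrite (l1E T) mulr_sumr.
  rewrite exchange_big; apply: ler_sum => U _ /=; rewrite geomE.
  apply: le_trans (ler_norm_sum _ _ _) _; apply: ler_sum => T _.
  by rewrite !normrM sign1 mul1r.
have l1X k : l1 (M ^+ k) <= l1 M ^+ k.
  elim: k => [|k IHk].
    rewrite !expr0 /l1 (bigD1 finset.set0) //= big1 => [|T /negPf T0].
      by rewrite ffunE eqxx normr1 addr0.
    by rewrite ffunE T0 normr0.
  rewrite !exprS; apply: le_trans (l1M _ _) _.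
  by rewrite ler_wpM2l // sumr_ge0.
apply: normed_cvg; apply: series_le_cvg (is_cvg_series_exp_coeff (l1 M)) => k //=.
  by rewrite divr_ge0 // exprn_ge0 // sumr_ge0.
rewrite ffunE normrM ger0_norm ?invr_ge0 // mulrC ler_wpM2r ?invr_ge0 //.
apply: le_trans (l1X k); rewrite /l1 (bigD1 S) //= lerDl.
by rewrite sumr_ge0.
Qed.

Definition cosh_mv M : multivector R n := 2^-1 *: (exp_mv M + exp_mv (- M)).
Definition sinh_mv M : multivector R n := 2^-1 *: (exp_mv M - exp_mv (- M)).

Definition commutator M N : multivector R n := 2^-1 *: (M * N - N * M).
Definition anticommutator M N : multivector R n := 2^-1 *: (M * N + N * M).

Definition blade (s : seq 'rV[R]_n) : multivector R n :=
  foldr (fun v M => wedge (vector_mv v) M) 1 s.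

End Algebra.

Section PrincipalAngles.
Context {R : realType} {n : nat}.
Implicit Types (V W : {vspace 'rV[R]_n}) (A : multivector R n).

Definition orthonormal_seq (s : seq 'rV[R]_n) : Prop :=
  forall i j, (i < size s)%N -> (j < size s)%N -> dotv s`_i s`_j = (i == j)%:R.

(* Indices start at 0 here: the mathematical theta_(i+1), e_(i+1), f_(i+1) are
   theta`_i, e`_i, f`_i. *)
Definition principal_bases (p : nat) V W (theta : p.-tuple R)
    (e f : p.-tuple 'rV[R]_n) : Prop :=
  [/\ basis_of V e /\ orthonormal_seq e,
      basis_of W f /\ orthonormal_seq f,
      sorted <=%R theta,
      forall i, (i < p)%N -> 0 <= theta`_i <= pi / 2 &
      forall i j, (i < p)%N -> (j < p)%N ->
        dotv e`_i f`_j = (i == j)%:R * cos theta`_i].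

Definition principal_bivector V W (e f : seq 'rV[R]_n) (i : nat) :
    multivector R n :=
  if (i < \dim (V :&: W))%N then 0
  else let ef := wedge (vector_mv e`_i) (vector_mv f`_i) in
       (norm_mv ef)^-1 *: ef.

Definition angle_bivector (p : nat) V W (theta : p.-tuple R)
    (e f : p.-tuple 'rV[R]_n) : multivector R n :=
  \sum_(i < p) theta`_i *: principal_bivector V W e f i.

(* The sign eps such that A = eps |A| e_1 ... e_p, for A a nonzero blade and e
   an orthonormal basis of its span. *)
Definition orientation A (e : seq 'rV[R]_n) : R :=
  if A == norm_mv A *: \prod_(u <- e) vector_mv u then 1 else -1.

(* The blades are A = blade v and B = blade w, so that [A] = <<v>> and
   [B] = <<w>> when they are nonzero. *)
Definition oriented_angle_bivector (p : nat) (v w : p.-tuple 'rV[R]_n)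
    (theta : p.-tuple R) (e f : p.-tuple 'rV[R]_n) : multivector R n :=
  let A := blade v in let B := blade w in
  let V := <<v>>%VS in let W := <<w>>%VS in
  if (A == 0) || (B == 0) then 0
  else if orientation A e * orientation B f == 1 then angle_bivector V W theta e f
  else angle_bivector V W theta e f - pi *: principal_bivector V W e f p.-1.

(* When B is a negative multiple of A != 0, the principal bivectors all vanish,
   so the oriented angle bivector is 0 although the anticommutator of the
   reversion of A with B is -|A||B|. *)
Definition opposite A (B : multivector R n) : Prop :=
  A != 0 /\ exists2 c : R, 0 < c & B = - c *: A.

End PrincipalAngles.

(* Main.v *)
From HB Require Import structures.
Require Import Defs.
From mathcomp Require Import all_boot all_order all_algebra ring lra.
From mathcomp Require Import all_classical all_reals all_analysis.
Import Order.TTheory GRing.Theory Num.Theory.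
Import numFieldNormedType.Exports.

Set Implicit Arguments.
Unset Strict Implicit.
Unset Printing Implicit Defensive.

Local Open Scope ring_scope.

(* Up to the orientations and norms, A~ B is (e_p ... e_1)(f_1 ... f_p).  Since
   e_j anticommutes with e_i and f_i for i != j, it equals the product of the
   e_i f_i = cos theta_i + e_i /\ f_i = exp (theta_i I_i), and as the I_i commute
   this product is exp Phi_{V,W}.  Likewise B A~ is the inverse exp (- Phi_{V,W}),
   and half the sum and difference of the two give cosh and sinh.  When the
   orientations disagree, the factor exp (- pi I_p) = -1 provides the sign, unless
   I_p = 0: then all angles vanish and B is a negative multiple of A. *)

(** * Vectors in the Clifford algebra *)

Section Vectors.
Context {R : realType} {n : nat}.
Implicit Types (S T U : {set 'I_n}) (M N : multivector R n) (u v : 'rV[R]_n).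

Lemma scale_mvE (a : R) M S : (a *: M) S = a * M S.
Proof. by rewrite ffunE. Qed.

Lemma one_mvE S : (1 : multivector R n) S = (S == finset.set0)%:R.
Proof. exact: ffunE. Qed.

Lemma dotvC u v : dotv u v = dotv v u.
Proof. by apply: eq_bigr => i _; rewrite mulrC. Qed.

Lemma dotv_is_linear u : linear (dotv u : 'rV[R]_n -> R^o).
Proof.
move=> a x y; rewrite /dotv scaler_sumr -big_split; apply: eq_bigr => i _ /=.
by rewrite !mxE mulrDr mulrCA.
Qed.

HB.instance Definition _ u :=
  GRing.isLinear.Build R 'rV[R]_n R^o _ (dotv u) (dotv_is_linear u).

Lemma dotvv_eq0 u : dotv u u = 0 -> u = 0.
Proof.
move/eqP; rewrite psumr_eq0 => [/allP u0|i _]; last by rewrite -expr2 sqr_ge0.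
apply/rowP => i; rewrite mxE; apply/eqP.
by have := u0 i (mem_index_enum i); rewrite mulf_eq0 orbb.
Qed.

Lemma vector_mv_is_linear : linear (vector_mv : 'rV[R]_n -> multivector R n).
Proof.
move=> a x y; apply/ffunP => S; rewrite [RHS]ffunE scale_mvE !ffunE.
rewrite mulr_sumr -big_split; apply: eq_bigr => i _ /=.
by rewrite !mxE mulrnDl mulrnAr.
Qed.

HB.instance Definition _ :=
  GRing.isLinear.Build R 'rV[R]_n (multivector R n) _ vector_mv vector_mv_is_linear.


Lemma dot_vector_mv u v : dot_mv (vector_mv u) (vector_mv v) = dotv u v.
Proof.
rewrite /dot_mv sum_vector_mv; apply: eq_bigr => i _; rewrite ffunE.
congr (_ * _); rewrite (bigD1 i) //= eqxx big1 ?addr0 // => j ji.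
by rewrite (inj_eq set1_inj) eq_sym (negPf ji).
Qed.

(** The main involution: the automorphism of the Clifford algebra that negates vectors. It makes the
    wedge product with a vector expressible by geometric products. *)
Definition grade_inv M : multivector R n :=
  [ffun S : {set 'I_n} => (-1) ^+ #|S| * M S].

Lemma sign_symdiff S T :
  (-1) ^+ #|symdiff S T| = (-1) ^+ #|S| * (-1) ^+ #|T| :> R.
Proof. by rewrite -!prodr_const prod_symdiff // => i; rewrite mulrNN mulr1. Qed.

Lemma grade_invM M N : grade_inv (M * N) = grade_inv M * grade_inv N.
Proof.
apply/ffunP => U; rewrite [LHS]ffunE !geomE mulr_sumr; apply: eq_bigr => S _.
rewrite !ffunE -[in LHS](symdiffK S U) sign_symdiff symdiffK.
by ring.
Qed.

Lemma grade_inv_is_linear : linear grade_inv.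
Proof.
move=> a M N; apply/ffunP => S; rewrite [RHS]ffunE scale_mvE !ffunE.
by rewrite mulrDr mulrCA.
Qed.

HB.instance Definition _ :=
  GRing.isLinear.Build R (multivector R n) (multivector R n) _ grade_inv
    grade_inv_is_linear.

Lemma grade_invK : involutive grade_inv.
Proof. by move=> M; apply/ffunP => S; rewrite !ffunE signrMK. Qed.

Lemma grade_inv1 : grade_inv 1 = 1.
Proof.
apply/ffunP => S; rewrite ffunE !one_mvE.
by case: eqP => [->|_]; rewrite ?mulr0 // cards0 mul1r.
Qed.

Lemma grade_inv_vector u : grade_inv (vector_mv u) = - vector_mv u.
Proof.
apply/ffunP => S; rewrite !ffunE mulr_sumr -sumrN; apply: eq_bigr => i _.
case: eqP => [->|_]; last by rewrite !mulr0n mulr0 oppr0.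
by rewrite cards1 expr1 mulN1r.
Qed.

(** Every [j] in [T] other than [i] satisfies exactly one of [i < j] and [j < i], so it contributes
    one factor -1 to the product of the two reordering signs. *)
Lemma reorder_sign_set1C T i :
  (-1) ^+ #|T| * reorder_sign T (finset.set1 i) =
  (-1) ^+ (i \in T) * reorder_sign (finset.set1 i) T :> R.
Proof.
have -> : (-1) ^+ (i \in T) = \prod_(j in T) (-1) ^+ (j == i) :> R.
  case: (boolP (i \in T)) => iT.
    rewrite (bigD1 i) //= eqxx big1 ?mulr1 // => j /andP[_ /negPf ->].
    by rewrite expr0.
  rewrite big1 // => j jT; case: eqP => // ji; by rewrite -ji jT in iT.
rewrite /reorder_sign big_set1 big_mkcondr -!prodr_const -!big_split.
apply: eq_bigr => j _ /=; rewrite big_mkcondr big_set1.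
by case: ltngtP => [ij|ij|/val_inj ->]; rewrite ?eqxx /=
  -?val_eqE /= ?(gtn_eqF ij) ?(ltn_eqF ij) ?mulrNN ?mulr1 ?mul1r ?expr0 ?expr1.
Qed.

(** For basis blades e_i and e_T the two summands agree when [i] is not in [T] and cancel when it
    is, so their mean keeps exactly the disjoint terms that define the wedge. *)
Lemma wedge_vectorl u M :
  wedge (vector_mv u) M =
  2^-1 *: (vector_mv u * M + grade_inv M * vector_mv u).
Proof.
apply/ffunP => U; rewrite [LHS]ffunE.
rewrite scale_mvE [in RHS]ffunE !geomE.
(* The substitution puts the summation index into the argument of [vector_mv u], the form that
   [sum_vector_mv] collapses to singletons. *)
rewrite [X in _ * (_ + X)](reindex_inj (inv_inj (symdiffK U))) /=.
under [X in _ * (X + _)]eq_bigr do rewrite mulrAC.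
under [X in _ * (_ + X)]eq_bigr => T _ do
  rewrite (symdiffC (symdiff U T)) symdiffK.
rewrite !sum_vector_mv -big_split mulr_sumr.
transitivity (\sum_(S : {set 'I_n})
    (\sum_(T : {set 'I_n} | [disjoint S & T] && (S :|: T == U)%SET)
       reorder_sign S T * M T) * vector_mv u S).
  by apply: eq_bigr => S _; rewrite mulr_suml; apply: eq_bigr => T _; rewrite mulrAC.
rewrite sum_vector_mv; apply: eq_bigr => i _ /=.
set V := symdiff (finset.set1 i) U.
have -> : symdiff U (finset.set1 i) = V by rewrite symdiffC.
(* For S = {i} the only candidate for [T] is [V], which is disjoint from {i} exactly when it does
   not contain [i]. *)
rewrite (eq_bigl (fun T => (i \notin V) && (T == V))) => [|T].
  rewrite /grade_inv ffunE; have := reorder_sign_set1C V i.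
  case: (i \in V) => /= E; last first.
    rewrite big_pred1_eq; rewrite expr0 mul1r in E.
    have -> : reorder_sign V (finset.set1 i) * ((-1) ^+ #|V| * M V) * u 0 i =
      ((-1) ^+ #|V| * reorder_sign V (finset.set1 i)) * (M V * u 0 i) by ring.
    rewrite E; by field.
  have -> : reorder_sign V (finset.set1 i) * ((-1) ^+ #|V| * M V) * u 0 i =
      ((-1) ^+ #|V| * reorder_sign V (finset.set1 i)) * (M V * u 0 i) by ring.
  by rewrite big_pred0 // E; field.
rewrite disjoints1 /V; apply/andP/andP => -[iT /eqP E]; split.
- by rewrite !inE eqxx -E !inE eqxx.
- apply/eqP/setP => j; rewrite -E !inE.
  by have [->|] := eqVneq j i; rewrite //= (negPf iT).
- by rewrite E.
- apply/eqP/setP => j; rewrite E !inE; have := iT; rewrite !inE eqxx.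
  by have [->|//] := eqVneq j i; rewrite /= negbK => ->.
Qed.
End Vectors.

(** * Blades *)

Section Blades.
Context {R : realType} {n : nat}.
Implicit Types (S T U : {set 'I_n}) (M N : multivector R n) (u v x : 'rV[R]_n).
Implicit Types s t e : seq 'rV[R]_n.

Lemma vector_mv_sqr u : vector_mv u * vector_mv u = (dotv u u)%:A.
Proof.
rewrite vector_mvM wedge_vectorl grade_inv_vector mulNr subrr scaler0.
by rewrite addr0.
Qed.

(** Polarization of [vector_mv_sqr]. *)
Lemma vector_mv_anticomm u v :
  vector_mv u * vector_mv v + vector_mv v * vector_mv u = (2 * dotv u v)%:A.
Proof.
have := vector_mv_sqr (u + v); rewrite !linearD /= (dotvC (u + v) u).
rewrite (dotvC (u + v) v) !linearD /= mulrDl !mulrDr !vector_mv_sqr.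
rewrite (dotvC v u) !scalerDl -!addrA => /addrI; rewrite !addrA.
by move/addIr => ->; rewrite mulr_natl mulr2n scalerDl.
Qed.

Lemma vector_mv_orthC u v : dotv u v = 0 ->
  vector_mv u * vector_mv v = - (vector_mv v * vector_mv u).
Proof.
by move=> uv; apply/eqP; rewrite -addr_eq0 vector_mv_anticomm uv mulr0 scale0r.
Qed.

Lemma wedge_is_linear u : linear (wedge (vector_mv u)).
Proof.
move=> a M N; rewrite !wedge_vectorl !linearP /= scalerA mulrC -scalerA -scalerDr.
by congr (_ *: _); rewrite mulrDl mulrDr -scalerAl -scalerAr addrACA scalerDr.
Qed.

HB.instance Definition _ u :=
  GRing.isLinear.Build R (multivector R n) (multivector R n) _
    (wedge (vector_mv u)) (wedge_is_linear u).

Lemma wedge_linearl M : linear (fun u => wedge (vector_mv u) M).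
Proof.
move=> a u v; rewrite !wedge_vectorl !linearP /= scalerA mulrC -scalerA -scalerDr.
by congr (_ *: _); rewrite mulrDl mulrDr -scalerAl -scalerAr addrACA scalerDr.
Qed.

(** Expanding by [wedge_vectorl], the mixed terms with [u] on both sides cancel, and what is left is
    a multiple of the commutator of [M] with the scalar u^2. *)
Lemma wedge_self u M : wedge (vector_mv u) (wedge (vector_mv u) M) = 0.
Proof.
rewrite !wedge_vectorl [grade_inv (_ *: _)]linearZ /= [grade_inv (_ + _)]linearD /=.
rewrite !grade_invM grade_invK grade_inv_vector.
rewrite -scalerAl -scalerAr -scalerDr mulrDr mulrDl !mulNr !mulrN mulNr !mulrA.
rewrite addrA addrK vector_mv_sqr -mulrA vector_mv_sqr mulr_algl mulr_algr.
by rewrite subrr !scaler0.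
Qed.

Lemma wedge_anticomm u v M :
  wedge (vector_mv u) (wedge (vector_mv v) M) =
  - wedge (vector_mv v) (wedge (vector_mv u) M).
Proof.
have wl := wedge_linearl.
have wD x y N : wedge (vector_mv (x + y)) N =
    wedge (vector_mv x) N + wedge (vector_mv y) N.
  by have := wl N 1 x y; rewrite !scale1r.
apply/eqP; rewrite -addr_eq0; have /eqP := wedge_self (u + v) M.
by rewrite !wD !linearD /= !wedge_self addr0 add0r.
Qed.

Lemma blade_linear t s : linear (fun x => blade (t ++ x :: s)).
Proof.
move=> a x y; elim: t => [|z t IHt] /=; first exact: wedge_linearl.
by rewrite IHt linearP.
Qed.

Lemma blade_move t x s :
  blade (t ++ x :: s) = (-1) ^+ size t *: blade (x :: t ++ s).
Proof.
elim: t => [|y t IHt] /=; first by rewrite scale1r.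
by rewrite IHt linearZ /= wedge_anticomm exprS mulN1r scaleNr scalerN.
Qed.

Lemma blade_rev s : blade (rev s) = (-1) ^+ 'C(size s, 2) *: blade s.
Proof.
elim: s => [|x s IHs]; first by rewrite scale1r.
rewrite rev_cons -cats1 blade_move cats0 size_rev /= IHs linearZ /= scalerA.
by rewrite -exprD binS bin1 addnC.
Qed.

Lemma blade_perm s t : perm_eq s t -> exists c : R, blade s = c *: blade t.
Proof.
elim: s t => [|x s IHs] t st.
  by exists 1; rewrite scale1r; move: st; rewrite perm_sym => /perm_nilP ->.
have xt : x \in t by rewrite -(perm_mem st) mem_head.
case/splitPr: xt st => t1 t2; rewrite perm_sym perm_catC /= perm_cons => st.
have {}st : perm_eq s (t1 ++ t2) by rewrite perm_sym perm_catC.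
have [c sc] := IHs _ st; exists ((-1) ^+ size t1 * c).
by rewrite blade_move /= sc linearZ scalerA mulrAC -expr2 sqrr_sign mul1r.
Qed.

Lemma blade_nuniq s : ~~ uniq s -> blade s = 0.
Proof.
elim: s => //= x s IHs; rewrite negb_and negbK => /orP[|/IHs ->]; last first.
  exact: linear0.
case/splitPr=> t1 t2; rewrite blade_move linearZ /= wedge_self.
exact: scaler0.
Qed.

(** Multilinear expansion in [e]: terms with a repeated vector vanish, and the others are blades of
    permutations of [e]. For an orthonormal basis [e], this makes a blade a multiple of the product
    of the basis. *)
Lemma blade_span e s : {subset s <= <<e>>%VS} -> size s = size e ->
  exists c : R, blade s = c *: blade e.
Proof.
(* [t] collects the entries already replaced by members of [e], and [r] those still to be
   expanded. *)
suff H k t r : size r = k -> {subset t <= e} -> {subset r <= <<e>>%VS} ->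
    size (t ++ r) = size e -> exists c : R, blade (t ++ r) = c *: blade e.
  by move=> se ss; apply: (H (size s) [::] s).
elim: k t r => [|k IHk] t [|x r] //= szr te re sze.
  rewrite cats0 in sze *; case: (boolP (uniq t)) => ut; last first.
    by exists 0; rewrite scale0r blade_nuniq.
  have [_ eqte] := uniq_min_size ut te (eq_leq (esym sze)).
  apply/blade_perm/uniq_perm => //.
  by apply: leq_size_uniq ut te _; rewrite sze.
have /(coord_span (X := in_tuple e)) -> : x \in <<in_tuple e>>%VS.
  by apply: re; rewrite mem_head.
apply: (big_rec (fun x => exists c : R, blade (t ++ x :: r) = c *: blade e)).
  (* The empty sum is a zero entry, and linearity makes the blade vanish there. *)
  exists 0; have := blade_linear t r (-1) 0 0.
  by rewrite scaler0 addr0 scaleN1r addNr scale0r.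
move=> i y _ [c IH].
have [||||c' IH'] := IHk (rcons t e`_i) r.
- by case: szr.
- by move=> z; rewrite mem_rcons in_cons => /orP[/eqP ->|/te //]; rewrite mem_nth.
- by move=> z zr; apply: re; rewrite in_cons zr orbT.
- by move: sze; rewrite cat_rcons !size_cat.
rewrite cat_rcons in IH'; exists (coord (in_tuple e) i x * c' + c).
by rewrite blade_linear IH IH' scalerA scalerDl.
Qed.

(** An orthogonal [u] anticommutes with each factor, and the grade involution absorbs these signs,
    so both summands of [wedge_vectorl] equal the geometric product. *)
Lemma wedge_orth u s : all (fun v => dotv u v == 0) s ->
  wedge (vector_mv u) (\prod_(v <- s) vector_mv v) =
  vector_mv u * \prod_(v <- s) vector_mv v.
Proof.
move=> us; rewrite wedge_vectorl.
suff -> : grade_inv (\prod_(v <- s) vector_mv v) * vector_mv u =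
    vector_mv u * \prod_(v <- s) vector_mv v.
  by rewrite -mulr2n -[X in _ *: X]scaler_nat scalerA mulVf ?scale1r // pnatr_eq0.
elim: s us => [_|v s IHs /= /andP[/eqP uv us]].
  by rewrite !big_nil grade_inv1 mul1r mulr1.
rewrite !big_cons grade_invM -mulrA IHs // grade_inv_vector !mulrA.
by rewrite mulNr -vector_mv_orthC.
Qed.

Lemma blade_orth s : pairwise (fun u v => dotv u v == 0) s ->
  blade s = \prod_(v <- s) vector_mv v.
Proof.
elim: s => [|u s IHs] /=; first by rewrite big_nil.
by case/andP=> us /IHs ->; rewrite wedge_orth // big_cons.
Qed.

Lemma reorder_sign_vector u S :
  reorder_sign S S * vector_mv u S = vector_mv u S.
Proof.
rewrite ffunE mulr_sumr; apply: eq_bigr => i _.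
case: eqP => [->|_]; last by rewrite mulr0.
rewrite mulr1n /reorder_sign big_set1 big_mkcondr big_set1 ltnn.
exact: mul1r.
Qed.

(** Self-adjointness comes from e_i e_i = 1: passing from [T] to [symdiff S T] changes the
    reordering sign by [reorder_sign S S], which is 1 on the support of a vector. Hence left
    multiplication by a unit vector is an isometry. *)
Lemma dot_mv_vectorl u M N :
  dot_mv (vector_mv u * M) N = dot_mv M (vector_mv u * N).
Proof.
rewrite /dot_mv.
under eq_bigr do rewrite geomE mulr_suml.
under [RHS]eq_bigr do rewrite geomE mulr_sumr.
rewrite exchange_big [RHS]exchange_big; apply: eq_bigr => S _ /=.
rewrite (reindex_inj (inv_inj (symdiffK S))); apply: eq_bigr => T _ /=.
rewrite symdiffK reorder_signDr -[in LHS](reorder_sign_vector u S).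
by ring.
Qed.

End Blades.

(** * Norms and products of vectors *)

Section Norms.
Context {R : realType} {n : nat}.
Implicit Types (S T U : {set 'I_n}) (M N : multivector R n) (u v x : 'rV[R]_n).
Implicit Types s e f : seq 'rV[R]_n.

Lemma dot_mvC M N : dot_mv M N = dot_mv N M.
Proof. by apply: eq_bigr => S _; rewrite mulrC. Qed.

Lemma dot_mv_is_linear M : linear (dot_mv M : multivector R n -> R^o).
Proof.
move=> a N P; rewrite /dot_mv scaler_sumr -big_split; apply: eq_bigr => S _ /=.
by rewrite ffunE scale_mvE mulrDr mulrCA.
Qed.

HB.instance Definition _ M :=
  GRing.isLinear.Build R (multivector R n) R^o _ (dot_mv M) (dot_mv_is_linear M).

Lemma dot_mvZ (a : R) M : dot_mv (a *: M) (a *: M) = a ^+ 2 * dot_mv M M.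
Proof. by rewrite linearZ /= [dot_mv _ M]dot_mvC linearZ /= expr2 -mulrA. Qed.

Lemma norm_mvZ (a : R) M : norm_mv (a *: M) = `|a| * norm_mv M.
Proof. by rewrite /norm_mv dot_mvZ sqrtrM ?sqr_ge0 // sqrtr_sqr. Qed.

Lemma dot_mv_vector_mul u M :
  dot_mv (vector_mv u * M) (vector_mv u * M) = dotv u u * dot_mv M M.
Proof.
by rewrite dot_mv_vectorl mulrA vector_mv_sqr mulr_algl linearZ.
Qed.

Lemma dot_mv11 : dot_mv (1 : multivector R n) 1 = 1.
Proof.
rewrite /dot_mv (bigD1 finset.set0) //= one_mvE eqxx mulr1 big1 ?addr0 // => S.
by rewrite one_mvE => /negPf ->; rewrite mulr0.
Qed.

Lemma norm_mv_prod s : all (fun u => dotv u u == 1) s ->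
  norm_mv (\prod_(u <- s) vector_mv u) = 1.
Proof.
rewrite /norm_mv => s1.
suff -> : dot_mv (\prod_(u <- s) vector_mv u) (\prod_(u <- s) vector_mv u) = 1.
  exact: sqrtr1.
elim: s s1 => [|u s IHs /= /andP[/eqP u1 s1]]; first by rewrite big_nil dot_mv11.
by rewrite big_cons dot_mv_vector_mul u1 mul1r IHs.
Qed.

Lemma wedge_vector u v : wedge (vector_mv u) (vector_mv v) =
  vector_mv u * vector_mv v - (dotv u v)%:A.
Proof. by rewrite vector_mvM [X in X - _]addrC addrK. Qed.

(** With P = uv and c = u.v, the relation vu = 2c - P gives P^2 = 2cP - 1, and completing the square
    yields (P - c)^2 = c^2 - 1. *)
Lemma wedge_vector_sqr u v : dotv u u = 1 -> dotv v v = 1 ->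
  wedge (vector_mv u) (vector_mv v) ^+ 2 = (dotv u v ^+ 2 - 1)%:A.
Proof.
move=> u1 v1; rewrite wedge_vector; set c := dotv u v.
set P := _ * _; have P2 : P * P = (2 * c) *: P - 1.
  rewrite /P -mulrA [vector_mv v * _]mulrA.
  have -> : vector_mv v * vector_mv u = (2 * c)%:A - P.
    by rewrite /c -vector_mv_anticomm addrAC subrr add0r.
  rewrite mulrBl mulrBr mulr_algl -scalerAr -/P /P -mulrA vector_mv_sqr v1.
  by rewrite scale1r mulr1 vector_mv_sqr u1 scale1r.
rewrite expr2 mulrBl !mulrBr P2 mulr_algl !mulr_algr scalerA scalerBl scale1r.
rewrite mulr_natl mulr2n scalerDl -expr2 opprB.
by rewrite [X in X + _ = _]addrAC addrK [LHS]addrC addrA subrK.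
Qed.

Lemma norm_wedge_vector u v : dotv u u = 1 -> dotv v v = 1 ->
  norm_mv (wedge (vector_mv u) (vector_mv v)) = Num.sqrt (1 - dotv u v ^+ 2).
Proof.
move=> u1 v1; rewrite /norm_mv wedge_vector; congr Num.sqrt.
set c := dotv u v; set P := _ * _.
have P1 : dot_mv 1 P = c.
  rewrite dot_mvC /P dot_mv_vectorl mulr1 dotvC in c *.
  by rewrite dot_vector_mv.
have PP : dot_mv P P = 1.
  by rewrite /P dot_mv_vector_mul u1 mul1r -[vector_mv v]mulr1
             dot_mv_vector_mul v1 mul1r dot_mv11.
(* The scalar [c] is the orthogonal projection of the unit multivector [P] onto the scalars, so
   Pythagoras gives the norm of [Q]. *)
set Q := P - _; have Q1 : dot_mv Q 1 = 0.
  by rewrite dot_mvC linearB linearZ /= P1 dot_mv11 /GRing.scale /= mulr1 subrr.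
rewrite {2}/Q linearB linearZ /= Q1 dot_mvC linearB linearZ /= PP.
rewrite [dot_mv P 1]dot_mvC P1 /GRing.scale /=.
by ring.
Qed.

(** The outermost factor a_(k-1) commutes with the pairs already formed inside, so it slides through
    them to its partner b_(k-1). *)
Lemma prod_rev_interleave (A : nzRingType) (a b : nat -> A) k :
  (forall i j, (j < i < k)%N -> GRing.comm (a i) (a j * b j)) ->
  (\prod_(x <- rev (mkseq a k)) x) * (\prod_(i < k) b i) =
  \prod_(i < k) (a i * b i).
Proof.
elim: k => [|k IHk] ab; first by rewrite !big_ord0 big_nil mulr1.
rewrite mkseqS rev_rcons big_cons !big_ord_recr /= -mulrA [X in _ * X]mulrA IHk.
  rewrite mulrA [X in X * _ = _]commr_prod ?mulrA // => i _.
  by apply: ab; rewrite ltn_ord ltnSn.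
by move=> i j /andP[ji ik]; apply: ab; rewrite ji ltnW.
Qed.

Lemma prod_vector_interleave p e f : size e = p -> size f = p ->
  (forall i j, (i < p)%N -> (j < p)%N -> i != j ->
     dotv e`_i e`_j = 0 /\ dotv e`_i f`_j = 0) ->
  (\prod_(u <- rev e) vector_mv u) * (\prod_(u <- f) vector_mv u) =
  \prod_(i < p) (vector_mv e`_i * vector_mv f`_i).
Proof.
move=> sze szf ef.
rewrite -(prod_rev_interleave (a := fun i => vector_mv e`_i)
                              (b := fun i => vector_mv f`_i)).
  rewrite [X in _ * X](big_nth 0) big_mkord szf; congr (_ * _).
  rewrite -[in LHS](mkseq_nth 0 e) sze /mkseq -!map_rev !big_map.
  by [].
move=> i j /andP[ji ip]; have jp := ltn_trans ji ip.
have [|ee ef'] := ef i j ip jp; first by rewrite gtn_eqF.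
rewrite /GRing.comm mulrA (vector_mv_orthC ee) mulNr -[X in - X]mulrA.
by rewrite (vector_mv_orthC ef') mulrN opprK mulrA.
Qed.

End Norms.

(** * The exponential *)

Section Exponential.
Local Open Scope classical_set_scope.
Local Open Scope ring_scope.
Context {R : realType}.

Lemma sum_triangle (V : nmodType) (F : nat -> nat -> V) m :
  \sum_(k < m) \sum_(i < k.+1) F i (k - i)%N =
  \sum_(i < m) \sum_(j < m - i) F i j.
Proof.
transitivity (\sum_(0 <= k < m) \sum_(0 <= i < m | (i <= k)%N) F i (k - i)%N).
  rewrite big_mkord; apply: eq_bigr => k _.
  by rewrite -(big_mkord xpredT (fun i => F i (k - i)%N)) (big_nat_widen _ _ m).
rewrite (exchange_big_dep_nat xpredT) //= big_mkord; apply: eq_bigr => i _.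
rewrite -(big_mkord xpredT) -(big_nat_widenl i 0 m xpredT) //.
rewrite -{1}[val i]add0n big_addn.
by apply: eq_bigr => j _; rewrite addnK.
Qed.

(** The algebra is arbitrary so that the same identities serve for multivectors and, in [R^o], for
    their norms. *)
Definition exp_sum (A : algType R) (x : A) (m : nat) : A :=
  \sum_(i < m) i`!%:R^-1 *: x ^+ i.

(** By the binomial theorem the partial sum for x + y collects the terms with i + j < m, whereas the
    product runs over the square i, j < m; the corner i + j >= m remains. *)
Lemma exp_sumD (A : algType R) (x y : A) m : GRing.comm x y ->
  exp_sum x m * exp_sum y m - exp_sum (x + y) m =
  \sum_(i < m) \sum_(m - i <= j < m)
     (i`!%:R^-1 *: x ^+ i) * (j`!%:R^-1 *: y ^+ j).
Proof.
move=> xy; pose F i j := (i`!%:R^-1 *: x ^+ i) * (j`!%:R^-1 *: y ^+ j).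
have -> : exp_sum (x + y) m = \sum_(k < m) \sum_(i < k.+1) F i (k - i)%N.
  apply: eq_bigr => k _; rewrite addrC (exprDn_comm k (commr_sym xy)) scaler_sumr.
  apply: eq_bigr => i _; rewrite /F -scalerAl -scalerAr scalerA.
  rewrite -[_ *+ 'C(_, _)]scaler_nat scalerA.
  have -> : y ^+ (k - i) * x ^+ i = x ^+ i * y ^+ (k - i).
    exact/esym/commrX/commr_sym/commrX.
  congr (_ *: _); have ik : (i <= k)%N by rewrite -ltnS.
  have fne j : j`!%:R != 0 :> R by rewrite pnatr_eq0 -lt0n fact_gt0.
  have /(congr1 (fun j => j%:R : R)) := bin_fact ik; rewrite !natrM => <-.
  have Cne : 'C(k, i)%:R != 0 :> R by rewrite pnatr_eq0 -lt0n bin_gt0.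
  by field; rewrite Cne !fne.
rewrite sum_triangle /exp_sum big_distrlr -sumrB; apply: eq_bigr => i _ /=.
rewrite -(big_mkord xpredT (F i)) -(big_mkord xpredT (F i)).
rewrite (big_cat_nat _ (leq_subr i m)) //=. by rewrite addrAC subrr add0r.
Qed.

Context {n : nat}.
Implicit Types (S T U : {set 'I_n}) (M N P : multivector R n).

(** This norm is submultiplicative, which [norm_mv] is not: 1 + e_1 has norm sqrt 2, but its square
    2 + 2 e_1 has norm 2 sqrt 2. *)
Definition l1_mv M : R := \sum_S `|M S|.

Lemma l1_mv_ge0 M : 0 <= l1_mv M.
Proof. exact: sumr_ge0. Qed.

Lemma le_l1_mv M S : `|M S| <= l1_mv M.
Proof. by rewrite /l1_mv (bigD1 S) //= lerDl sumr_ge0. Qed.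

Lemma l1_mvZ (a : R) M : l1_mv (a *: M) = `|a| * l1_mv M.
Proof.
by rewrite /l1_mv mulr_sumr; apply: eq_bigr => S _; rewrite scale_mvE normrM.
Qed.

Lemma l1_mv_sum (I : Type) (r : seq I) (Q : pred I) (F : I -> multivector R n) :
  l1_mv (\sum_(i <- r | Q i) F i) <= \sum_(i <- r | Q i) l1_mv (F i).
Proof.
apply: (big_ind2 (fun M (a : R) => l1_mv M <= a)) => // [|M a N b Ma Nb].
  by rewrite /l1_mv big1 // => S _; rewrite ffunE normr0.
apply: le_trans (lerD Ma Nb); rewrite /l1_mv -big_split; apply: ler_sum => S _.
by rewrite ffunE ler_normD.
Qed.

(** Up to signs, the geometric product is convolution on the group of subsets under symmetric
    difference, and the l^1 norm is invariant under its translations. *)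
Lemma l1_mvM M N : l1_mv (M * N) <= l1_mv M * l1_mv N.
Proof.
have sign1 S T : `|reorder_sign S T : R| = 1.
  rewrite /reorder_sign normr_prod big1 // => i _.
  by rewrite normr_prod big1 // => j _; rewrite normrN1.
have l1E S : l1_mv N = \sum_U `|N (symdiff S U)|.
  by rewrite [LHS](reindex_inj (inv_inj (symdiffK S))).
rewrite {2}/l1_mv mulr_suml.
under [leRHS]eq_bigr => S _ do rewrite (l1E S) mulr_sumr.
rewrite exchange_big; apply: ler_sum => U _ /=; rewrite geomE.
apply: le_trans (ler_norm_sum _ _ _) _; apply: ler_sum => S _.
by rewrite !normrM sign1 mul1r.
Qed.

Lemma l1_mvX M k : l1_mv (M ^+ k) <= l1_mv M ^+ k.
Proof.
elim: k => [|k IHk].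
  rewrite !expr0 /l1_mv (bigD1 finset.set0) //= one_mvE eqxx normr1 big1 ?addr0 //.
  by move=> S /negPf S0; rewrite one_mvE S0 normr0.
rewrite !exprS; apply: le_trans (l1_mvM _ _) _.
by rewrite ler_wpM2l // l1_mv_ge0.
Qed.

Lemma exp_mv_cvg M S :
  exp_sum M m S @[m --> \oo] --> exp_mv M S.
Proof.
rewrite ffunE; have := @is_cvg_exp_mv R n M S; apply: cvg_trans.
apply: near_eq_cvg; apply: nearW => m.
rewrite /series /= big_mkord /exp_sum.
by elim/big_rec2: _ => [|i a b _ ->]; rewrite !ffunE.
Qed.

Lemma exp_mv_eq M S (l : R) : exp_sum M m S @[m --> \oo] --> l -> exp_mv M S = l.
Proof.
move=> Ml; rewrite -(cvg_lim (@Rhausdorff R) Ml).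
exact/esym/(cvg_lim (@Rhausdorff R))/exp_mv_cvg.
Qed.

Lemma expR_cvg (a : R) : exp_sum (a : R^o) m @[m --> \oo] --> expR a.
Proof.
have := @is_cvg_series_exp_coeff R a; apply: cvg_trans.
apply: near_eq_cvg; apply: nearW => m.
rewrite /series /= big_mkord /exp_sum.
by apply: eq_bigr => i _; rewrite /exp_coeff /= mulrC.
Qed.

Lemma mulmv_cvg (f g : nat -> multivector R n) M N :
  (forall S, f m S @[m --> \oo] --> M S) ->
  (forall S, g m S @[m --> \oo] --> N S) ->
  forall S, (f m * g m) S @[m --> \oo] --> (M * N) S.
Proof.
move=> fM gN S; rewrite geomE; under eq_fun do rewrite geomE.
apply: cvg_big => [|T _]; first exact: add_continuous.
by apply: cvgM; [apply: cvgMr|].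
Qed.

(* The l^1 norm of exp_sum M m * exp_sum N m - exp_sum (M + N) m is at most the
   same difference for the real numbers l1_mv M and l1_mv N. *)
Lemma exp_mvD M N : GRing.comm M N -> exp_mv (M + N) = exp_mv M * exp_mv N.
Proof.
move=> MN; apply/ffunP => S.
pose a : R^o := l1_mv M; pose b : R^o := l1_mv N.
pose D m := exp_sum M m * exp_sum N m - exp_sum (M + N) m.
pose d m := exp_sum a m * exp_sum b m - exp_sum (a + b) m.
have Dd m : l1_mv (D m) <= d m.
  rewrite /D /d !exp_sumD //; last exact: mulrC.
  apply: le_trans (l1_mv_sum _ _ _) _; apply: ler_sum => i _.
  apply: le_trans (l1_mv_sum _ _ _) _; apply: ler_sum => j _.
  apply: le_trans (l1_mvM _ _) _; rewrite !l1_mvZ.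
  apply: ler_pM; rewrite ?mulr_ge0 ?l1_mv_ge0 // ger0_norm ?invr_ge0 //.
    by rewrite ler_wpM2l ?invr_ge0 // l1_mvX.
  by rewrite ler_wpM2l ?invr_ge0 // l1_mvX.
(* For real numbers this is the addition formula of [expR]. *)
have d0 : d m @[m --> \oo] --> (0 : R).
  rewrite -(subrr (expR (a + b))) {1}expRD.
  by apply: cvgB; [apply: cvgM|]; exact: expR_cvg.
have D0 : D m S @[m --> \oo] --> (0 : R).
  apply: norm_cvg0; apply: (squeeze_cvgr _ (cvg_cst 0) d0).
  apply: nearW => m; rewrite normr_ge0 /=.
  exact: le_trans (le_l1_mv _ _) (Dd m).
apply: exp_mv_eq.
have -> : (fun m => exp_sum (M + N) m S) =
    (fun m => (exp_sum M m * exp_sum N m) S - D m S).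
  by apply/funext => m; rewrite /D [X in _ - X]ffunE [X in _ - (_ + X)]ffunE subKr.
rewrite -[X in _ --> X]subr0; apply: cvgB => //.
by apply: mulmv_cvg => T; exact: exp_mv_cvg.
Qed.

Lemma exp_mv0 : exp_mv (0 : multivector R n) = 1.
Proof.
apply/ffunP => S; apply: exp_mv_eq.
apply: cvg_near_cst; near=> m.
(* The constant term is present only for m > 0; the empty partial sum is 0. *)
have -> : m = m.-1.+1 by rewrite prednK //; near: m; exact: nbhs_infty_gt.
rewrite /exp_sum big_ord_recl expr0 fact0 invr1 scale1r big1 ?addr0 // => i _.
by rewrite expr0n scaler0.
Unshelve. all: by end_near. Qed.

Lemma exp_mvN M : exp_mv M * exp_mv (- M) = 1.
Proof. by rewrite -exp_mvD ?subrr ?exp_mv0 // /GRing.comm mulrN mulNr. Qed.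

Lemma exp_mv_sum k (x : nat -> multivector R n) :
  (forall i j, (j < i < k)%N -> GRing.comm (x i) (x j)) ->
  exp_mv (\sum_(i < k) x i) = \prod_(i < k) exp_mv (x i).
Proof.
elim: k => [|k IHk] cx; first by rewrite !big_ord0 exp_mv0.
rewrite !big_ord_recr /= exp_mvD ?IHk // => [i j /andP[ji ik]|].
  by apply: cx; rewrite ji ltnW.
by apply/commr_sym/commr_sum => i _; apply: cx; rewrite ltn_ord ltnSn.
Qed.

(** Euler's formula, with [M] as the imaginary unit: the even powers form the cosine series, and the
    odd powers the sine series times [M]. *)
Lemma exp_mv_cos_sin (t : R) M : M ^+ 2 = -1 ->
  exp_mv (t *: M) = (cos t)%:A + sin t *: M.
Proof.
move=> M2; apply/ffunP => S; rewrite [RHS]ffunE !scale_mvE.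
apply: exp_mv_eq.
have -> : (fun m => exp_sum (t *: M) m S) = (fun m =>
    series (cos_coeff t) m * (1 : multivector R n) S + series (sin_coeff t) m * M S).
  apply/funext => m; rewrite /series /= !big_mkord !mulr_suml -big_split /=.
  rewrite sum_ffunE; apply: eq_bigr => i _.
  rewrite exprZn !scale_mvE -[in M ^+ i](odd_double_half i).
  rewrite exprD -mul2n exprM M2 /cos_coeff /sin_coeff /=.
  have -> : (-1 : multivector R n) ^+ i./2 = ((-1) ^+ i./2 : R)%:A.
    by rewrite -scaleN1r exprZn expr1n.
  rewrite mulr_algr scale_mvE; case: (boolP (odd i)) => oi /=.
    have -> : i.-1./2 = i./2 by rewrite -[in LHS](odd_double_half i) oi /= half_double.
    by rewrite expr1 -?exprnP; ring.
  by rewrite expr0 -?exprnP; ring.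
by apply: cvgD; apply: cvgM (cvg_cst _); rewrite ?cos.unlock ?sin.unlock;
  [exact: is_cvg_series_cos_coeff|exact: is_cvg_series_sin_coeff].
Qed.

End Exponential.

(** * Principal angles *)

Section PrincipalAngles.
Context {R : realType} {n p : nat}.
Implicit Types (M N : multivector R n) (u x y : 'rV[R]_n) (s : seq 'rV[R]_n).

Lemma commrZ M N (a : R) : GRing.comm M N -> GRing.comm M (a *: N).
Proof. by move=> MN; rewrite /GRing.comm -scalerAl -scalerAr MN. Qed.

Lemma orthonormal_seq_rev s : orthonormal_seq s -> orthonormal_seq (rev s).
Proof.
move=> so i j; rewrite size_rev => si sj; rewrite !nth_rev // so; last 2 first.
- by rewrite ltn_subrL (leq_ltn_trans _ si).
- by rewrite ltn_subrL (leq_ltn_trans _ sj).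
congr (nat_of_bool _)%:R; apply/eqP/eqP => [|->] //.
by move=> /(congr1 (subn (size s))); rewrite !subKn // => -[].
Qed.

Lemma orthonormal_seq_pairwise s :
  orthonormal_seq s -> pairwise (fun x y => dotv x y == 0) s.
Proof.
move=> so; apply/(pairwiseP 0) => i j; rewrite !inE => si sj ij.
by rewrite so // ltn_eqF.
Qed.

Lemma orthonormal_seq_unit s : orthonormal_seq s -> all (fun u => dotv u u == 1) s.
Proof. by move=> so; apply/(all_nthP 0) => i si; rewrite so // eqxx. Qed.

(** Both products are blades by orthogonality, so the sign is that of [blade_rev]. *)
Lemma orthonormal_blade_rev s : orthonormal_seq s ->
  \prod_(u <- rev s) vector_mv u =
  (-1) ^+ 'C(size s, 2) *: \prod_(u <- s) vector_mv u.
Proof.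
move=> so; rewrite -!blade_orth ?blade_rev //.
  exact: orthonormal_seq_pairwise.
exact/orthonormal_seq_pairwise/orthonormal_seq_rev.
Qed.

Lemma prod_mul_rev s : all (fun u => dotv u u == 1) s ->
  (\prod_(u <- s) vector_mv u) * (\prod_(u <- rev s) vector_mv u) = 1.
Proof.
elim: s => [|x s IHs] /=; first by rewrite big_nil mulr1.
case/andP=> /eqP x1 /IHs s1; rewrite rev_cons big_cons big_rcons /=.
by rewrite mulrA -[X in X * _]mulrA s1 mulr1 vector_mv_sqr x1 scale1r.
Qed.

Lemma orthonormal_expansion k s x : size s = k -> orthonormal_seq s ->
  x \in << s >>%VS -> x = \sum_(i < k) dotv x s`_i *: s`_i.
Proof.
move=> <- so /(coord_span (X := in_tuple s)) xE; rewrite {1}xE.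
apply: eq_bigr => i _; congr (_ *: _); rewrite {2}xE dotvC linear_sum /=.
rewrite (bigD1 i) //= linearZ /= so // eqxx big1 => [|j ji].
  by rewrite addr0 /GRing.scale /= mulr1.
by rewrite linearZ /= so // eq_sym (inj_eq val_inj) (negPf ji) scaler0.
Qed.

(** [orientation] tests only the sign +1 and defaults to -1. The default is right here because the
    product of unit vectors has norm 1, which forces [c] to be plus or minus the norm of [M]. *)
Lemma orientation_eq s M (c : R) : all (fun u => dotv u u == 1) s ->
  M = c *: \prod_(u <- s) vector_mv u ->
  M = (orientation M s * norm_mv M) *: \prod_(u <- s) vector_mv u.
Proof.
move=> s1 Mc; rewrite /orientation; case: eqP => [{1}->|]; first by rewrite mul1r.
have -> : norm_mv M = `|c| by rewrite Mc norm_mvZ norm_mv_prod // mulr1.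
case: (lerP 0 c) => c0; first by rewrite Mc ger0_norm.
by rewrite mulN1r ltr0_norm // opprK.
Qed.

Lemma orientation_cases M s : orientation M s = 1 \/ orientation M s = -1.
Proof. by rewrite /orientation; case: ifP => _; [left|right]. Qed.

Lemma exp_mvN_eq M N : N * exp_mv M = 1 -> exp_mv (- M) = N.
Proof. by move=> NM; rewrite -[LHS]mul1r -NM -mulrA exp_mvN mulr1. Qed.

Context (V W : {vspace 'rV[R]_n}) (theta : p.-tuple R) (e f : p.-tuple 'rV[R]_n).
Context (bases : principal_bases V W theta e f).

Let orthe : orthonormal_seq e. Proof. by case: bases => -[]. Qed.
Let orthf : orthonormal_seq f. Proof. by case: bases => _ []. Qed.

Let dotef i j : (i < p)%N -> (j < p)%N ->
  dotv e`_i f`_j = (i == j)%:R * cos theta`_i.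
Proof. by case: bases => _ _ _ _; exact. Qed.

Let dotee i j : (i < p)%N -> (j < p)%N -> dotv e`_i e`_j = (i == j)%:R.
Proof. by move=> ip jp; apply: orthe; rewrite size_tuple. Qed.

Let dotff i j : (i < p)%N -> (j < p)%N -> dotv f`_i f`_j = (i == j)%:R.
Proof. by move=> ip jp; apply: orthf; rewrite size_tuple. Qed.

Lemma principal_sin_gt0 i : (i < p)%N -> theta`_i != 0 -> 0 < sin theta`_i.
Proof.
case: bases => _ _ _ bnd _ ip ti0; have /andP[t0 tpi] := bnd _ ip.
apply: sin_gt0_pi; rewrite lt_neqAle eq_sym ti0 t0 /=.
by apply: le_lt_trans tpi _; have := pi_gt0 R; lra.
Qed.

(** The squared distance of the two unit vectors is 2 - 2 cos 0 = 0. *)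
Lemma principal_vector_eq i : (i < p)%N -> theta`_i = 0 -> e`_i = f`_i.
Proof.
move=> ip t0; apply/eqP; rewrite -subr_eq0; apply/eqP/dotvv_eq0.
rewrite linearB /= dotvC linearB /= [dotv (_ - _) _]dotvC linearB /=.
rewrite dotee // dotff // [dotv f`_i e`_i]dotvC dotef // eqxx t0 cos0 mul1r.
by rewrite !subrr.
Qed.

(** This links the dimension tested in [principal_bivector] with the angles. Zero angles come first
    and give common vectors of V and W; conversely, a common vector has no component along e_j once
    theta_j > 0. *)
Lemma principal_angle_eq0 i : (i < p)%N ->
  (theta`_i == 0) = (i < \dim (V :&: W))%N.
Proof.
case: bases => -[/andP[/eqP eV freee] _] [/andP[/eqP fW _] _] srt bnd _ ip.
have mono k l : (k <= l)%N -> (l < p)%N -> theta`_k <= theta`_l.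
  move=> kl lp; apply: le_sorted_leq_nth; rewrite ?inE ?size_tuple //.
  exact: leq_ltn_trans lp.
apply/idP/idP => [/eqP ti0|].
  (* By monotonicity all angles up to index [i] vanish, so the i + 1 independent vectors e_j = f_j
     lie in the intersection. *)
  have sub : (<<take i.+1 e>> <= V :&: W)%VS.
    apply/span_subvP => u /(nthP 0)[j]; rewrite size_takel ?size_tuple // => ji <-.
    have jp := leq_trans ji ip; rewrite nth_take // memv_cap -{1}eV -fW.
    have tj0 : theta`_j = 0.
      apply/le_anti; have /andP[-> _] := bnd j jp; rewrite andbT.
      by have := mono j i ji ip; rewrite ti0.
    rewrite {2}(principal_vector_eq jp tj0).
    by rewrite !memv_span ?mem_nth ?size_tuple.
  apply: leq_trans (dimvS sub).
  move: freee; rewrite -{1}(cat_take_drop i.+1 e) => /catl_free.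
  by rewrite /free => /eqP ->; rewrite size_takel ?size_tuple.
apply: contraTT => ti0; rewrite -leqNgt.
suff sub : (V :&: W <= <<take i e>>)%VS.
  apply: leq_trans (dimvS sub) _; apply: leq_trans (dim_span _) _.
  by rewrite size_take_min geq_minl.
apply/subvP => x; rewrite memv_cap -eV -fW => /andP[xV xW].
have xe := orthonormal_expansion (size_tuple e) orthe xV.
have xf := orthonormal_expansion (size_tuple f) orthf xW.
rewrite xe; apply: memv_suml => j _.
have jp := ltn_ord j.
have [ji|ij] := ltnP j i.
  rewrite memvZ // memv_span //; apply/(nthP 0).
  by exists j; rewrite ?nth_take // size_takel // size_tuple ltnW.
have neq k : k != j -> (k == j :> nat) = false by exact: negbTE.
(* As [x] lies in both spaces, its coordinates along e_j and f_j are each cos theta_j times the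
   other, so sin^2 theta_j times the first is 0. *)
have xej : dotv x e`_j = cos theta`_j * dotv x f`_j.
  rewrite {1}xf dotvC linear_sum /= (bigD1 j) //=.
  rewrite linearZ /= dotef // eqxx mul1r big1 ?addr0 => [|k /neq kj].
    by rewrite /GRing.scale /= mulrC.
  by rewrite linearZ /= dotef // eq_sym kj mul0r scaler0.
have xfj : dotv x f`_j = cos theta`_j * dotv x e`_j.
  rewrite {1}xe dotvC linear_sum /= (bigD1 j) //=.
  rewrite linearZ /= [dotv f`_j _]dotvC dotef // eqxx mul1r big1 ?addr0.
    by rewrite /GRing.scale /= mulrC.
  move=> k /neq kj.
  by rewrite linearZ /= [dotv f`_j _]dotvC dotef // kj mul0r scaler0.
have sj : 0 < sin theta`_j.
  apply: principal_sin_gt0 => //; apply: contraNneq ti0 => tj0.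
  apply/eqP/le_anti; have /andP[-> _] := bnd i ip; rewrite andbT.
  by have := mono _ _ ij jp; rewrite tj0.
suff -> : dotv x e`_j = 0 by rewrite scale0r mem0v.
have /eqP : sin theta`_j ^+ 2 * dotv x e`_j = 0.
  by rewrite sin2cos2 mulrBl mul1r expr2 -mulrA -xfj -xej subrr.
by rewrite mulf_eq0 expf_eq0 /= (gt_eqF sj) => /eqP.
Qed.

Let I := principal_bivector V W e f.

(** By [norm_wedge_vector] the normalizing norm is sin theta_i, which is positive from index
    [\dim (V :&: W)] on. *)
Lemma principal_bivectorE i : (i < p)%N -> (\dim (V :&: W) <= i)%N ->
  sin theta`_i *: I i = wedge (vector_mv e`_i) (vector_mv f`_i).
Proof.
move=> ip di; rewrite /I /principal_bivector ltnNge di /=.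
rewrite norm_wedge_vector ?dotee ?dotff ?eqxx // dotef // eqxx mul1r.
have s0 : 0 < sin theta`_i.
  by apply: principal_sin_gt0; rewrite // principal_angle_eq0 // -leqNgt.
by rewrite -sin2cos2 sqrtr_sqr gtr0_norm // scalerA divff ?scale1r // gt_eqF.
Qed.

Lemma principal_bivector_sqr i : (i < p)%N -> (\dim (V :&: W) <= i)%N ->
  I i ^+ 2 = -1.
Proof.
move=> ip di; have s0 : 0 < sin theta`_i.
  by apply: principal_sin_gt0; rewrite // principal_angle_eq0 // -leqNgt.
have s2 : sin theta`_i ^+ 2 != 0 by rewrite expf_eq0 /= gt_eqF.
apply: (scalerI s2); rewrite -exprZn principal_bivectorE // wedge_vector_sqr.
- by rewrite dotef // eqxx mul1r sin2cos2 scalerN -scaleNr opprB.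
- by rewrite dotee // eqxx.
- by rewrite dotff // eqxx.
Qed.

(** Past the intersection, cos theta_i + sin theta_i I_i is the sum of the inner and wedge products
    of e_i and f_i. Within it, e_i = f_i is a unit vector, and its square is exp 0. *)
Lemma exp_principal_bivector i : (i < p)%N ->
  exp_mv (theta`_i *: I i) = vector_mv e`_i * vector_mv f`_i.
Proof.
move=> ip; have [di|id] := leqP (\dim (V :&: W)) i.
  rewrite exp_mv_cos_sin ?principal_bivector_sqr // principal_bivectorE //.
  by rewrite vector_mvM dotef // eqxx mul1r.
have t0 : theta`_i = 0 by apply/eqP; rewrite principal_angle_eq0.
rewrite t0 scale0r exp_mv0 (principal_vector_eq ip t0) vector_mv_sqr.
by rewrite dotff // eqxx scale1r.
Qed.

(** A nonzero I_i is a multiple of e_i f_i minus a scalar. For distinct indices each vector of one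
    pair anticommutes with both vectors of the other, so the two products commute. *)
Lemma principal_bivector_comm i j : (i < p)%N -> (j < p)%N ->
  GRing.comm (I i) (I j).
Proof.
move=> ip jp; have [->|ij] := eqVneq i j; first exact: commr_refl.
have cK : GRing.comm (vector_mv e`_i * vector_mv f`_i)
                     (vector_mv e`_j * vector_mv f`_j).
  have c x : dotv x e`_j = 0 -> dotv x f`_j = 0 ->
      GRing.comm (vector_mv e`_j * vector_mv f`_j) (vector_mv x).
    move=> xe xf; rewrite /GRing.comm [RHS]mulrA (vector_mv_orthC xe) mulNr.
    by rewrite -[in RHS]mulrA (vector_mv_orthC xf) mulrN opprK mulrA.
  apply/commr_sym/commrM; apply: c; rewrite ?dotee ?dotff ?dotef // ?(negPf ij) //.
  - by rewrite mul0r.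
  - by rewrite dotvC dotef // eq_sym (negPf ij) mul0r.
have cA M (a : R) : GRing.comm M a%:A by apply/commrZ/commr1.
rewrite /I /principal_bivector; case: ifP => _; first exact/commr_sym/commr0.
case: ifP => _; first exact: commr0.
apply/commrZ/commr_sym/commrZ; rewrite !wedge_vector.
apply: commrB; last exact: cA.
by apply/commr_sym/commrB; [exact: cK|exact: cA].
Qed.

Lemma exp_angle_bivector : exp_mv (angle_bivector V W theta e f) =
  (\prod_(u <- rev e) vector_mv u) * (\prod_(u <- f) vector_mv u).
Proof.
rewrite (prod_vector_interleave (p := p)) ?size_tuple //; last first.
  by move=> i j ip jp ij; rewrite dotee // dotef // (negPf ij) mul0r.
rewrite /angle_bivector (exp_mv_sum (x := fun i => theta`_i *: I i)).
  by apply: eq_bigr => i _; rewrite exp_principal_bivector.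
move=> i j /andP[ji ip]; apply/commrZ/commr_sym/commrZ.
by apply: principal_bivector_comm => //; exact: ltn_trans ip.
Qed.

(** The two products over [rev e] meet in the middle and give the sign (-1)^(p(p-1)/2); the two
    products over [f] then meet and give the same sign. *)
Lemma prod_vector_inverse :
  (\prod_(u <- f) vector_mv u * \prod_(u <- rev e) vector_mv u) *
  (\prod_(u <- rev e) vector_mv u * \prod_(u <- f) vector_mv u) = 1.
Proof.
have sq s : size s = p -> orthonormal_seq s ->
    (\prod_(u <- s) vector_mv u) * (\prod_(u <- s) vector_mv u) =
    ((-1) ^+ 'C(p, 2) : R)%:A.
  move=> sp so; rewrite -[LHS](signrZK 'C(p, 2)) [X in _ *: X]scalerAr.
  by rewrite -sp -orthonormal_blade_rev // prod_mul_rev // orthonormal_seq_unit.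
rewrite mulrA -[X in X * _]mulrA sq ?size_rev ?size_tuple //; last first.
  exact: orthonormal_seq_rev.
rewrite mulr_algr -scalerAl sq ?size_tuple // scalerA -expr2 sqrr_sign.
exact: scale1r.
Qed.

(** [o] records that the orientations disagree. In that case the hypothesis makes I_p, which has
    index [p.-1], square to -1, whence exp(- pi I_p) = -1. *)
Lemma exp_oriented (o : bool) (Phi := angle_bivector V W theta e f -
    (if o then pi else 0) *: I p.-1) : (o -> \dim (V :&: W) < p)%N ->
  exp_mv Phi = (-1) ^+ o *:
    (\prod_(u <- rev e) vector_mv u * \prod_(u <- f) vector_mv u) /\
  exp_mv (- Phi) = (-1) ^+ o *:
    (\prod_(u <- f) vector_mv u * \prod_(u <- rev e) vector_mv u).
Proof.
move=> od; set E := _ * _; set E' := _ * \prod_(u <- rev e) _.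
have EE : exp_mv Phi = (-1) ^+ o *: E.
  rewrite /Phi; case: o od {Phi} => [/(_ isT) dp|_]; last first.
    by rewrite scale0r subr0 exp_angle_bivector scale1r.
  have p0 : (p.-1 < p)%N by rewrite prednK ?(leq_ltn_trans _ dp).
  rewrite -scaleNr exp_mvD; last first.
    apply/commr_sym/commr_sum => i _; apply/commrZ/commr_sym/commrZ.
    exact: principal_bivector_comm.
  rewrite exp_mv_cos_sin ?principal_bivector_sqr //; last first.
    by rewrite -ltnS prednK ?(leq_ltn_trans _ dp).
  rewrite cosN sinN cospi sinpi oppr0 scale0r addr0 mulr_algr.
  by rewrite exp_angle_bivector.
split=> //; apply: exp_mvN_eq; rewrite EE -scalerAl -scalerAr scalerA -expr2.
by rewrite sqrr_sign scale1r prod_vector_inverse.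
Qed.

End PrincipalAngles.

(** * Commutator and anticommutator of two blades *)

Lemma norm_mv_eq0 (R : realType) (n : nat) (M : multivector R n) :
  norm_mv M = 0 -> M = 0.
Proof.
have ge0 S : 0 <= M S * M S by rewrite -expr2 sqr_ge0.
move/eqP; rewrite sqrtr_eq0 => M0; have : dot_mv M M == 0.
  by rewrite eq_le M0 sumr_ge0.
rewrite psumr_eq0 // => /allP H; apply/ffunP => S.
by have := H S (mem_index_enum S); rewrite mulf_eq0 orbb ffunE => /eqP.
Qed.

Theorem theorem5p10 (R : realType) (n p : nat) (hp : (0 < p)%N)
    (v w : p.-tuple 'rV[R]_n)
    (theta : p.-tuple R) (e f : p.-tuple 'rV[R]_n)
    (hbases : blade v != 0 -> blade w != 0 ->
       principal_bases <<v>>%VS <<w>>%VS theta e f) :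
  let A := blade v in
  let B := blade w in
  let A_rev := blade (rev v) in
  let Phi := oriented_angle_bivector v w theta e f in
  (~ opposite A B ->
     anticommutator A_rev B = (norm_mv A * norm_mv B) *: cosh_mv Phi)
  /\ commutator A_rev B = (norm_mv A * norm_mv B) *: sinh_mv Phi.
Proof.
move=> A B A_rev Phi.
have revE : A_rev = (-1) ^+ 'C(p, 2) *: A.
  by rewrite /A_rev blade_rev size_tuple.
(* If a blade vanishes, there need be no principal bases, but both products and the product of the
   norms are 0. *)
have [AB0|] := boolP ((A == 0) || (B == 0)).
  have norm0 : norm_mv (0 : multivector R n) = 0.
    by rewrite -(scale0r (0 : multivector R n)) norm_mvZ normr0 mul0r.
  have [ABr BAr nAB] :
      [/\ A_rev * B = 0, B * A_rev = 0 & norm_mv A * norm_mv B = 0].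
    rewrite revE; case/orP: AB0 => /eqP ->.
      by rewrite scaler0 mulr0 mul0r norm0 mul0r.
    by rewrite mulr0 mul0r norm0 mulr0.
  rewrite /commutator /anticommutator ABr BAr nAB subrr addr0.
  by rewrite !scaler0 !scale0r.
rewrite negb_or => /andP[A0 B0]; have bases := hbases A0 B0.
have [[/andP[/eqP eV _] orthe] [/andP[/eqP fW _] orthf] _ _ _] := bases.
have prodE (s t : p.-tuple 'rV[R]_n) :
    orthonormal_seq t -> <<t>>%VS = << s >>%VS ->
    blade s = (orientation (blade s) t * norm_mv (blade s)) *:
              \prod_(u <- t) vector_mv u.
  move=> ot ts; have [||c sc] := @blade_span _ _ t s; rewrite ?size_tuple //.
    by move=> u us; rewrite ts memv_span.
  apply: (orientation_eq (c := c)); first exact: orthonormal_seq_unit.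
  by rewrite sc blade_orth //; exact: orthonormal_seq_pairwise.
have AE := prodE v e orthe eV; have BE := prodE w f orthf fW.
rewrite -/A in AE; rewrite -/B in BE.
pose o := orientation A e * orientation B f != 1.
have oE : orientation A e * orientation B f = (-1) ^+ o.
  rewrite /o; case: (orientation_cases A e) => ->;
    case: (orientation_cases B f) => ->;
    by rewrite ?mulN1r ?mulrN1 ?opprK ?mulr1 ?eqxx // -subr_eq0 -opprD oppr_eq0
               (_ : 1 + 1 = 2%:R) // pnatr_eq0.
set E := \prod_(u <- rev e) vector_mv u * \prod_(u <- f) vector_mv u.
set E' := \prod_(u <- f) vector_mv u * \prod_(u <- rev e) vector_mv u.
(* [A_rev] and the product over [rev e] carry the same sign (-1)^(p(p-1)/2), so the coefficient is
   that of [A]. *)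
have revAE : A_rev =
    (orientation A e * norm_mv A) *: \prod_(u <- rev e) vector_mv u.
  by rewrite revE {1}AE orthonormal_blade_rev // size_tuple !scalerA mulrC.
pose c := norm_mv A * norm_mv B.
have ABE : A_rev * B = c *: ((-1) ^+ o *: E).
  rewrite revAE {1}BE -scalerAl -scalerAr !scalerA -oE /c.
  by congr (_ *: _); ring.
have BAE : B * A_rev = c *: ((-1) ^+ o *: E').
  rewrite revAE {1}BE -scalerAl -scalerAr !scalerA -oE /c.
  by congr (_ *: _); ring.
have PhiE : Phi = angle_bivector <<v>>%VS <<w>>%VS theta e f -
    (if o then pi else 0) *: principal_bivector <<v>>%VS <<w>>%VS e f p.-1.
  rewrite /Phi /oriented_angle_bivector -/A -/B (negPf A0) (negPf B0) /= /o.
  by case: ifP; rewrite //= scale0r subr0.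
rewrite /commutator /anticommutator /cosh_mv /sinh_mv ABE BAE.
(* The implication fails only when the orientations differ and the two spans coincide. *)
have [od|] := boolP (o ==> (\dim (<<v>> :&: <<w>>) < p)%N).
  have [] := exp_oriented bases (implyP od); rewrite -PhiE => -> ->.
  by rewrite -scalerDr -scalerBr !scalerA !(mulrC c).
rewrite negb_imply -leqNgt => /andP[sgn pd].
have pi0 i : (i < p)%N -> principal_bivector <<v>>%VS <<w>>%VS e f i = 0.
  by move=> ip; rewrite /principal_bivector (leq_trans ip pd).
have Phi0 : Phi = 0.
  rewrite PhiE pi0 ?prednK // scaler0 subr0 /angle_bivector big1 // => i _.
  by rewrite pi0 // scaler0.
(* All angles vanish too, so the bases agree. The two products [E] and [E'] are then equal, which
   makes the commutator 0, in accordance with [Phi0]. *)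
have ef : e = f.
  apply/eq_from_tnth => i; rewrite !(tnth_nth 0).
  apply: (principal_vector_eq bases) => //; apply/eqP.
  by rewrite (principal_angle_eq0 bases) // (leq_trans _ pd).
have EE' : E = E'.
  by rewrite /E /E' ef orthonormal_blade_rev // -scalerAl -scalerAr.
split=> [nopp|]; last first.
  by rewrite Phi0 oppr0 EE' !subrr !scaler0.
case: nopp; split=> //.
have nA : norm_mv A != 0 by apply: contraNneq A0 => /norm_mv_eq0 ->.
have nB : norm_mv B != 0 by apply: contraNneq B0 => /norm_mv_eq0 ->.
(* With e = f and opposite orientations, B/|B| = - A/|A|, which gives the ratio of the norms. *)
exists (norm_mv B / norm_mv A).
  by rewrite divr_gt0 // lt_neqAle eq_sym ?nA ?nB sqrtr_ge0.
have oBA : orientation B f = - orientation A e.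
  move: oE; rewrite sgn expr1.
  case: (orientation_cases A e) => ->; first by rewrite mul1r.
  by rewrite mulN1r opprK => /(congr1 -%R); rewrite !opprK.
rewrite {1}BE {2}AE oBA -ef scalerA; congr (_ *: _).
by field.
Qed.
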